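(* Let $E$ and $E'$ be real Banach spaces of dimension at least two and let $G\subset E$, $G'\subset E'$ be domains. If $f:\overline G\to\overline{G'}$ is a homeomorphism that is $\eta$-quasisymmetric relative to $\delta G$ and maps $G$ onto $G'$, and if $G$ is a distance $c$-John domain, then $G'$ is a distance $c'$-John domain, where $c'=c'(c,\eta)$ depends only on $c$ and $\eta$.
   Context: A domain is an open connected set. The norm is written $|\cdot|$; $\delta G=\overline G\setminus G$ is the boundary of $G$, and $\delta_G(x)=\inf\{|x-y|:y\in\delta G\}$ for $x\in G$. A curve is a continuous map from a closed interval; it joins its endpoints. For $c\ge1$, a domain $G\subsetneq E$ is distance $c$-John if each pair of points $x_1,x_2\in G$ can be joined by a curve $\gamma$ in $G$ with $\min_{j=1,2}|x_j-x|\le c\,\delta_G(x)$ for all $x\in\gamma$. Quasisymmetry: a triple in a metric space $X$ is an ordered sequence $T=(x,y,z)$ of three distinct points, with ratio $\rho(T)=|y-x|/|z-x|$. For $A\subset X$, $T=(x,y,z)$ is a triple in the pair $(X,A)$ if $x\in A$ or $\{y,z\}\subset A$. Given a homeomorphism $\eta:[0,\infty)\to[0,\infty)$, an embedding $f:X\to Y$ of metric spaces is $\eta$-quasisymmetric relative to $A$ if $\rho(f(T))\le\eta(\rho(T))$ for every triple $T$ in $(X,A)$, where $f(T)=(f(x),f(y),f(z))$. Here $X=\overline G$, $A=\delta G$. *)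

(* Defs.v *)
From mathcomp Require Import all_boot all_order all_algebra.
From mathcomp Require Import all_classical all_reals all_analysis.

Set Implicit Arguments.
Unset Strict Implicit.
Unset Printing Implicit Defensive.

Import Order.TTheory GRing.Theory Num.Theory.
Import numFieldNormedType.Exports.

Local Open Scope classical_set_scope.
Local Open Scope ring_scope.

(* Maps between subsets are represented by total functions, of which only the
   restriction to the source set matters; continuity is always that of the
   restriction. *)
Definition homeomorphism_between (T U : topologicalType)
    (A : set T) (B : set U) (f : T -> U) : Prop :=
  set_bij A B f /\ {within A, continuous f} /\
  exists g : U -> T, (forall x, A x -> g (f x) = x) /\ {within B, continuous g}.

Definition embedding_on (T U : topologicalType) (A : set T) (f : T -> U) : Prop :=
  homeomorphism_between A (f @` A) f.

Definition dim_ge2 (R : realType) (E : normedModType R) : Prop :=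
  exists u v : E, forall a b : R, a *: u + b *: v = 0 -> a = 0 /\ b = 0.

Definition domain (T : topologicalType) (G : set T) : Prop :=
  open G /\ connected G.

(* The boundary of an open set. *)
Definition bdry (T : topologicalType) (G : set T) : set T := closure G `\` G.

(* Only meaningful when [bdry G] is nonempty; this is the case for every
   nonempty open G <> setT in a normed space. *)
Definition bdry_dist (R : realType) (E : normedModType R) (G : set E) (x : E) : R :=
  inf [set `|x - y| | y in bdry G].

Definition distance_John (R : realType) (E : normedModType R) (c : R)
    (G : set E) : Prop :=
  [/\ domain G, G <> setT &
    forall x1 x2 : E, G x1 -> G x2 ->
      exists (a b : R) (gamma : R -> E),
        [/\ a <= b, {within `[a, b], continuous gamma},
            gamma a = x1, gamma b = x2 &
            forall t : R, a <= t <= b ->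
              G (gamma t) /\
              Num.min `|x1 - gamma t| `|x2 - gamma t|
                <= c * bdry_dist G (gamma t)]].

Definition triple_ratio (R : realType) (E : normedModType R) (x y z : E) : R :=
  `|y - x| / `|z - x|.

Definition triple_in (T : Type) (X A : set T) (x y z : T) : Prop :=
  [/\ X x, X y & X z] /\ [/\ x <> y, y <> z & x <> z] /\
  (A x \/ (A y /\ A z)).

Definition rel_quasisymmetric (R : realType) (E E' : normedModType R)
    (eta : R -> R) (X A : set E) (f : E -> E') : Prop :=
  embedding_on X f /\
  forall x y z : E, triple_in X A x y z ->
    triple_ratio (f x) (f y) (f z) <= eta (triple_ratio x y z).

(* Main.v *)
Require Import Defs.
From mathcomp Require Import all_boot all_order all_algebra.
From mathcomp Require Import all_classical all_reals all_analysis.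

Set Implicit Arguments.
Unset Strict Implicit.
Unset Printing Implicit Defensive.

Import Order.TTheory GRing.Theory Num.Theory.
Import numFieldNormedType.Exports.
Local Open Scope classical_set_scope.
Local Open Scope ring_scope.

(** The curve required in [G'] is the image under [f] of a curve given by the
    John condition of [G].  Let [x] be a point of the latter, say with
    [`|x1 - x| <= c * bdry_dist G x], and let [y'] be any boundary point of
    [G'].  Since [f] is a bijection of the closures and maps [G] onto [G'],
    [y' = f y] for some [y] in [bdry G], and [`|x1 - x| <= c * `|x - y|], so
    that [`|x1 - y| <= (c + 1) * `|x - y|].  Neither [x] nor [x1] is a boundary
    point, but [y] is, so quasisymmetry applies to the triple with vertex [y]:
    it gives [`|f x1 - f y| <= M * `|f x - f y|], where [M] bounds [eta] on
    [`[0, c + 1]].  Hence [`|f x1 - f x| <= (M + 1) * `|f x - f y|]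
    ([dist_image_le]).  Taking the infimum over [y'] shows that [c' = M + 1]
    works.

    The infimum is over a nonempty set because a proper nonempty open subset of
    a normed space has a boundary point ([bdry_nonempty]); its image lies
    outside [G'], so [G'] is again proper. *)

(** A normed space is a union of segments issuing from the origin. *)
Lemma normed_connectedT (R : realType) (E : normedModType R) :
  connected [set: E].
Proof.
pose seg (v : E) : set E := (fun t : R => t *: v) @` `[0, 1].
have -> : [set: E] = \bigcup_(v in [set: E]) seg v.
  apply/esym/seteqP; split=> // v _; exists v => //.
  by exists 1; rewrite ?scale1r //= in_itv /= ler01 lexx.
apply: bigcup_connected.
  by exists 0 => v _; exists 0; rewrite ?scale0r //= in_itv /= lexx ler01.
move=> v _; apply: (connected_continuous_connected (@segment_connected _ _ _)).
by apply: continuous_subspaceT; apply: scalel_continuous.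
Qed.

Lemma bdry_nonempty (R : realType) (E : normedModType R) (G : set E) :
  open G -> G <> setT -> G !=set0 -> bdry G !=set0.
Proof.
move=> oG GT G0; apply: contrapT => /nonemptyPn bG0; apply: GT.
have clG : closed G.
  move=> x Gx; apply: contrapT => nGx.
  by have : bdry G x by []; rewrite bG0.
by apply: (normed_connectedT G0); exists G; rewrite ?setTI.
Qed.

Lemma bdry_dist_le (R : realType) (E : normedModType R) (G : set E) (x y : E) :
  bdry G y -> bdry_dist G x <= `|x - y|.
Proof.
move=> Gy; apply: ge_inf; last by exists y.
by exists 0 => _ [z _ <-].
Qed.

Lemma within_continuous_compose (T U V : topologicalType) (A : set T)
    (B : set U) (f : T -> U) (g : U -> V) :
  {within A, continuous f} -> {within B, continuous g} ->
  (forall x, A x -> B (f x)) -> {within A, continuous (g \o f)}.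
Proof.
move=> /subspace_continuousP fc /subspace_continuousP gc AB.
apply/subspace_continuousP => x Ax.
have fx : f z @[z --> within A (nbhs x)] --> within B (nbhs (f x)).
  move=> C /(fc x Ax); rewrite !nbhs_simpl /within /=.
  by apply: filterS => z zC Az; apply: zC => //; apply: AB.
exact: (cvg_comp _ _ fx (gc _ (AB _ Ax))).
Qed.

Lemma control_bounded (R : realType) (eta : R -> R) (b : R) : 0 <= b ->
  homeomorphism_between (T := R) (U := R) `[0, +oo[ `[0, +oo[ eta ->
  exists2 M : R, 0 <= M & forall t, 0 <= t <= b -> eta t <= M.
Proof.
move=> b0 [[etapos _ _] [etac _]].
have sub : ([set` `[0, b]] : set R) `<=` [set` `[0, +oo[].
  by move=> t /=; rewrite !in_itv /= => /andP[-> _].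
have [s] := EVT_max b0 (continuous_subspaceW sub etac).
rewrite in_itv /= => /andP[s0 _] smax; exists (eta s).
  have /etapos : `[0, +oo[%classic s by rewrite /= in_itv /= s0.
  by rewrite /= in_itv /= andbT.
by move=> t tb; apply: smax; rewrite in_itv.
Qed.

(** Of the points [x1], [x] and [y] only [y] lies on the boundary, so a
    controlled triple made of them must have [y] as its vertex.  The distances
    from [y] are therefore compared first, and [x1] is then related to [x]
    through [y]. *)
Lemma dist_image_le (R : realType) (E E' : normedModType R) (eta : R -> R)
    (c M : R) (G : set E) (f : E -> E') (x1 x y : E) :
  0 <= M -> (forall t, 0 <= t <= c + 1 -> eta t <= M) ->
  rel_quasisymmetric eta (closure G) (bdry G) f ->
  G x1 -> G x -> bdry G y -> `|x1 - x| <= c * `|x - y| ->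
  `|f x1 - f x| <= (M + 1) * `|f x - f y|.
Proof.
move=> M0 etaM [[[_ finj _] _] qs] Gx1 Gx [cGy nGy] hx.
have [->|x1x] := eqVneq x1 x.
  by rewrite subrr normr0 mulr_ge0 // addr_ge0.
have cG := @subset_closure _ G.
have yx : y <> x by move=> e; apply: nGy; rewrite e.
have yx1 : y <> x1 by move=> e; apply: nGy; rewrite e.
have xy0 : 0 < `|x - y|.
  by rewrite normr_gt0 subr_eq0 eq_sym; apply/eqP.
have fxy0 : 0 < `|f x - f y|.
  rewrite normr_gt0 subr_eq0; apply/eqP => e; apply: yx; apply/esym.
  by apply: finj; rewrite ?inE //; apply: cG.
have ratio_le : triple_ratio y x1 x <= c + 1.
  rewrite /triple_ratio ler_pdivrMr // mulrDl mul1r.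
  by apply: le_trans (ler_distD x _ _) _; rewrite lerD2r.
have : triple_ratio (f y) (f x1) (f x) <= M.
  apply: le_trans (qs y x1 x _) _.
    split; first by split=> //; apply: cG.
    by split; [split=> //; apply/eqP | left].
  by apply: etaM; rewrite ratio_le andbT divr_ge0.
rewrite /triple_ratio ler_pdivrMr // => fx1y.
apply: le_trans (ler_distD (f y) _ _) _.
by rewrite mulrDl mul1r [X in _ + X]distrC lerD2r.
Qed.

Lemma bdry_preimage (T U : topologicalType) (G : set T) (G' : set U)
    (f : T -> U) (y' : U) :
  homeomorphism_between (closure G) (closure G') f -> f @` G = G' ->
  bdry G' y' -> exists2 y, bdry G y & f y = y'.
Proof.
move=> [[_ _ fsurj] _] fG [cy' ny']; have [y cy fy] := fsurj _ cy'.
exists y => //; split=> // Gy; apply: ny'.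
by rewrite -fG -fy; exists y.
Qed.

Lemma proper_image (R : realType) (E : normedModType R) (U : topologicalType)
    (G : set E) (G' : set U) (f : E -> U) :
  homeomorphism_between (closure G) (closure G') f -> f @` G = G' ->
  open G -> G <> setT -> G !=set0 -> G' <> setT.
Proof.
move=> [[_ finj _] _] fG oG GT G0 G'T.
have [y [cy nGy]] := bdry_nonempty oG GT G0.
have : G' (f y) by rewrite G'T.
rewrite -fG => -[z Gz fzy]; apply: nGy.
suff <- : z = y by [].
by apply: finj; rewrite ?inE //; apply: subset_closure.
Qed.

Theorem corollary1p13 (R : realType) (c : R) (eta : R -> R) (hc : 1 <= c)
    (heta : homeomorphism_between (T := R) (U := R) `[0, +oo[ `[0, +oo[ eta) :
  exists c' : R, 1 <= c' /\
    forall (E E' : completeNormedModType R) (G : set E) (G' : set E')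
      (f : E -> E'),
      dim_ge2 E -> dim_ge2 E' ->
      domain G -> domain G' ->
      homeomorphism_between (closure G) (closure G') f ->
      rel_quasisymmetric eta (closure G) (bdry G) f ->
      f @` G = G' ->
      distance_John c G ->
      distance_John c' G'.
Proof.
have c0 : 0 <= c by apply: le_trans hc.
have [M M0 etaM] := control_bounded (addr_ge0 c0 ler01) heta.
exists (M + 1); split; first by rewrite lerDr.
move=> E E' G G' f _ _ _ domG' homf qsf fG [[oG _] GT johnG].
have G'T : G' <> setT.
  have [G0|/nonemptyPn G0] := pselect (G !=set0).
    exact: (proper_image homf fG oG GT G0).
  (* An empty [G'] is proper because [E'] contains the origin. *)
  by rewrite -fG G0 image_set0 => /seteqP[_ /(_ 0 I)].
split=> //; rewrite -{1 2}fG => _ _ [x1 Gx1 <-] [x2 Gx2 <-].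
have [a [b [gamma [ab gc ga gb gG]]]] := johnG _ _ Gx1 Gx2.
exists a, b, (f \o gamma); split=> //=; rewrite ?ga ?gb //.
  apply: within_continuous_compose gc (homf.2.1) _ => t /=.
  by rewrite in_itv /= => /gG[Gt _]; apply: subset_closure.
move=> t /gG[Gt]; set x := gamma t => minx.
have G'x : G' (f x) by rewrite -fG; exists x.
split=> //.
have bG'0 : bdry G' !=set0.
  by apply: bdry_nonempty domG'.1 G'T _; exists (f x).
have john_image xi : G xi -> `|xi - x| <= c * bdry_dist G x ->
    `|f xi - f x| <= (M + 1) * bdry_dist G' (f x).
  move=> Gxi hxi; rewrite mulrC -ler_pdivrMr ?ltr_wpDl //.
  apply: lb_le_inf.
    by have [y' by'] := bG'0; exists `|f x - y'|, y'.
  move=> _ [y' by' <-]; have [y Gy <-] := bdry_preimage homf fG by'.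
  rewrite ler_pdivrMr ?ltr_wpDl // mulrC.
  apply: (dist_image_le M0 etaM qsf) => //.
  by apply: le_trans hxi _; rewrite ler_wpM2l // bdry_dist_le.
move: minx; rewrite !ge_min => /orP[h|h]; apply/orP; [left|right];
  exact: john_image.
Qed.
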